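(* Let $X$ be a real Banach space and let $A\colon X\rightrightarrows X^*$ be maximally monotone with $\operatorname{int}\operatorname{dom}A\neq\varnothing$. (i) Then $\widehat{A}=A$, i.e. for every $x\in X$, $$Ax=\bigcap_{\varepsilon>0}\overline{\operatorname{conv}\left[A(x+\varepsilon B_X)\right]}^{w*}.$$ In particular, $A$ has property (Q), and so $\operatorname{gra}A$ is norm $\times$ weak$^*$ closed. (ii) Moreover, if $S\subseteq\operatorname{int}\operatorname{dom}A$ is dense in $\operatorname{int}\operatorname{dom}A$ and $$\widehat{A_S}(x):=\bigcap_{\varepsilon>0}\overline{\operatorname{conv}\left[A\big(S\cap(x+\varepsilon B_X)\big)\right]}^{w*},\qquad x\in X,$$ then $$\widehat{A_S}(x)\supseteq\overline{\operatorname{conv}\left[A_S(x)\right]}^{w*}\quad\text{for all }x\in X,$$ and $$Ax=\widehat{A_S}(x)+\operatorname{rec}A(x)\quad\text{for all }x\in X.$$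
   Context: $X$ is a real Banach space with norm $\|\cdot\|$, continuous dual $X^*$, pairing $\langle\cdot,\cdot\rangle$ and closed unit ball $B_X$. A set-valued operator $A\colon X\rightrightarrows X^*$ assigns to each $x\in X$ a (possibly empty) set $Ax\subseteq X^*$; $\operatorname{gra}A=\{(x,x^* )\mid x^*\in Ax\}$, $\operatorname{dom}A=\{x\mid Ax\neq\varnothing\}$, and $A(E)=\bigcup_{x\in E}Ax$ for $E\subseteq X$. $A$ is monotone if $\langle x-y,x^*-y^*\rangle\ge 0$ for all $(x,x^* ),(y,y^* )\in\operatorname{gra}A$, and maximally monotone if it is monotone and has no proper monotone extension (in the sense of graph inclusion). $\overline{D}^{w*}$ is the weak$^*$ closure of $D\subseteq X^*$; $\operatorname{conv}$ is the convex hull. The operator $\widehat{A}\colon X\rightrightarrows X^*$ is defined by $\widehat{A}(x)=\bigcap_{\varepsilon>0}\overline{\operatorname{conv}[A(x+\varepsilon B_X)]}^{w*}$. $A$ has property (Q) if for every net $(x_\alpha)_{\alpha\in J}$ in $X$ with $x_\alpha\to x$ in norm, $\bigcap_{\alpha\in J}\overline{\operatorname{conv}\big[\bigcup_{\beta\succeq_J\alpha}A(x_\beta)\big]}^{w*}\subseteq Ax$. For $S\subseteq\operatorname{dom}A$, the operator $A_S$ is defined by letting $\operatorname{gra}A_S$ be the norm $\times$ weak$^*$ closure of $\operatorname{gra}A\cap(S\times X^* )$; that is, $x^*\in A_S(x)$ iff there is a net $(x_\alpha,x^*_\alpha)$ in $\operatorname{gra}A$ with $x_\alpha\in S$, $x_\alpha\to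 x$ in norm and $x_\alpha^*\to x^*$ weak$^*$. For $x\in X$, $\operatorname{rec}A(x)$ is the set of $x^*\in X^*$ for which there exist sequences $t_n\to0^+$ (positive reals) and $(a_n,a_n^* )\in\operatorname{gra}A$ with $a_n\to x$ in norm and $t_na_n^*\to x^*$ weak$^*$. The notation $\widehat{A_S}$ is to be read exactly as displayed in the claim. Sums of sets are Minkowski sums, and the sum of any set with the empty set is empty. *)

(* Defs.v *)
From HB Require Import structures.
From mathcomp Require Import all_boot all_order all_algebra.
From mathcomp Require Import all_classical all_reals all_analysis.

Set Implicit Arguments.
Unset Strict Implicit.
Unset Printing Implicit Defensive.

Import Order.TTheory GRing.Theory Num.Theory.
Import numFieldNormedType.Exports.

Local Open Scope classical_set_scope.
Local Open Scope ring_scope.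

Section Dual.
Context {R : realType} {X : completeNormedModType R}.

Definition linear_continuous_fun : {pred X -> R^o} :=
  [pred f : X -> R^o | `[< linear f /\ continuous f >]].

Fact linear_continuous_fun_submod : submod_closed linear_continuous_fun.
Proof.
split.
  apply/asboolP; split; first by move=> a u v /=; rewrite scaler0 addr0.
  by move=> x; exact: cst_continuous.
move=> a f g /asboolP[lf cf] /asboolP[lg cg]; apply/asboolP; split.
  move=> b u v; rewrite /= !fctE lf lg.
  by rewrite !scalerDr !scalerA [a * b]mulrC addrACA.
by move=> x; apply: continuousD;
  [apply: continuousZ; [exact: cst_continuous|exact: cf]|exact: cg].
Qed.

HB.instance Definition _ :=
  GRing.isSubmodClosed.Build R (X -> R^o) linear_continuous_fun
    linear_continuous_fun_submod.

End Dual.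

(* The continuous dual X^* as a vector space, without a canonical topology. *)
Record dual (R : realType) (X : completeNormedModType R) := Dual {
  dual_fun :> X -> R^o ;
  dual_funP : dual_fun \in linear_continuous_fun }.

Section DualStructure.
Context (R : realType) (X : completeNormedModType R).

HB.instance Definition _ := [isSub for @dual_fun R X].
HB.instance Definition _ := [Choice of dual X by <:].
HB.instance Definition _ := [SubChoice_isSubLmodule of dual X by <:].

End DualStructure.

(* X^* with the weak^* topology: the one induced by pointwise convergence. *)
Definition weak_star (R : realType) (X : completeNormedModType R) :=
  initial_topology (fun f : dual X => (f : {ptws X -> R^o})).

HB.instance Definition _ (R : realType) (X : completeNormedModType R) :=
  Topological.on (weak_star X).

Section Operators.
Context {R : realType} {X : completeNormedModType R}.
Implicit Types (A B : X -> set (dual X)) (D : set (dual X)) (E S : set X).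

Definition pairing (x : X) (xs : dual X) : R := xs x.

Definition ws_closure D : set (dual X) := closure (D : set (weak_star X)).

Definition conv_hull D : set (dual X) := smallest (@convex_set R (dual X)) D.

Definition minkowski_sum (C D : set (dual X)) : set (dual X) :=
  [set a + b | a in C & b in D].

Definition unit_ball : set X := [set u | `|u| <= 1].

(* x + eps B_X *)
Definition ball_around (x : X) (eps : R) : set X :=
  [set x + eps *: u | u in unit_ball].

Definition gra A : set (X * dual X) := [set p | A p.1 p.2].

Definition dom A : set X := [set x | A x !=set0].

Definition op_image A E : set (dual X) := \bigcup_(x in E) A x.

Definition monotone_op A : Prop :=
  forall x xs y ys, gra A (x, xs) -> gra A (y, ys) ->
    0 <= pairing (x - y) (xs - ys).

Definition maximally_monotone A : Prop :=
  monotone_op A /\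
  forall B, monotone_op B -> gra A `<=` gra B -> gra B = gra A.

Definition hat_op A (x : X) : set (dual X) :=
  \bigcap_(eps in [set e : R | 0 < e])
    ws_closure (conv_hull (op_image A (ball_around x eps))).

Definition directed_set (J : Type) (le : J -> J -> Prop) : Prop :=
  [/\ inhabited J,
      forall a, le a a,
      forall a b c, le a b -> le b c -> le a c &
      forall a b, exists c, le a c /\ le b c].

Definition net_tails (J : Type) (le : J -> J -> Prop) : set_system J :=
  filter_from [set: J] (fun a => [set b | le a b]).

Definition property_Q A : Prop :=
  forall (J : Type) (le : J -> J -> Prop) (x_ : J -> X) (x : X),
    directed_set le -> x_ @ net_tails le --> x ->
    \bigcap_(a in [set: J])
      ws_closure (conv_hull (\bigcup_(b in [set b | le a b]) A (x_ b)))
    `<=` A x.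

Definition norm_ws_closure (G : set (X * dual X)) : set (X * dual X) :=
  closure (G : set (X * weak_star X)).

Definition norm_ws_closed (G : set (X * dual X)) : Prop :=
  closed (G : set (X * weak_star X)).

(* The operator A_S. *)
Definition restr_op A S (x : X) : set (dual X) :=
  [set xs | norm_ws_closure (gra A `&` (S `*` setT)) (x, xs)].

(* The operator written \widehat{A_S}; it is built from A and S directly and
   is not [hat_op (restr_op A S)]. *)
Definition hat_restr_op A S (x : X) : set (dual X) :=
  \bigcap_(eps in [set e : R | 0 < e])
    ws_closure (conv_hull (op_image A (S `&` ball_around x eps))).

Definition rec_op A (x : X) : set (dual X) :=
  [set xs | exists (t : nat -> R) (a : nat -> X) (as_ : nat -> dual X),
    [/\ forall n, 0 < t n, t @ \oo --> (0 : R),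
        forall n, gra A (a n, as_ n),
        a @ \oo --> x &
        (fun n => t n *: as_ n : weak_star X) @ \oo --> (xs : weak_star X)]].

End Operators.

(* Main.v *)
Require Import Defs.
From mathcomp Require Import all_boot all_order all_algebra.
From mathcomp Require Import all_classical all_reals all_analysis.
From mathcomp Require Import ring lra.

(** Everything rests on one estimate. Let [y] be interior to [dom A]. By
    monotonicity, each point of the domain bounds the pairings of the graph
    elements from above by an affine expression, so the graph elements, divided
    by a suitable affine function of the pairing with [u - y], form a pointwise
    bounded family; Banach-Steinhaus turns this into the coercivity estimate
    <<⟨h, us⟩ <= K |h| (⟨x - y, us⟩ + C)>> for all [us] in [A u] and [u] near an
    arbitrary point [x], possibly on the boundary of the domain
    ([local_coercivity]). Its right-hand side is affine and weak-star continuous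
    in [us].

    Part (i). For [u] near [x], monotonicity against a graph point, corrected by
    the coercivity estimate, is a closed affine inequality in [us]. It therefore
    survives convex hulls and weak-star closures, and as the radius shrinks the
    correction vanishes: every element of [hat_op A x] is monotonically related
    to the graph, hence lies in [A x] ([hat_op_sub]). Property (Q) and closedness
    of the graph follow because tails of nets and neighbourhoods of graph points
    are absorbed by the balls that define [hat_op].

    Part (ii). The inclusion of the hull of [A_S] holds because
    [hat_restr_op A S x] is convex, weak-star closed and contains [A_S x]. For
    the decomposition, [rec_op A x] lies in the normal cone of [dom A] at [x]
    ([rec_op_normal]), and adding a normal vector preserves monotone relatedness;
    this gives one inclusion. Conversely, let [a] be in [A x]. One looks for [c]
    in [hat_restr_op A S x] such that [a - c] is normal, that is, such that
    <<⟨y - x, a⟩ <= ⟨y - x, c⟩>> for all [y] interior to [dom A]. For one [y] such a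
    [c] is a weak-star cluster point of values of [A] at points of [S] that
    approach [x] along the segment towards [y] ([hat_restr_op_support]). To find
    one [c] for all [y] simultaneously, a minimax principle is used
    ([system_solvable]): a convex family of linear inequalities, each of which
    is solvable in a convex set, is solvable in its weak-star closure as soon as
    finitely many of the inequalities force boundedness. The family indexed by [y]
    is convex because the interior of [dom A] is convex, which is itself proved
    by the same minimax principle, applied to the inequalities that say that a
    functional belongs to [A w] for [w] on a segment ([segment_dom]). *)

Set Implicit Arguments.
Unset Strict Implicit.
Unset Printing Implicit Defensive.

Import Order.TTheory GRing.Theory Num.Theory.
Import numFieldNormedType.Exports.

Local Open Scope classical_set_scope.
Local Open Scope ring_scope.

(** * The duality pairing and the weak-star topology *)

Arguments pairing : simpl never.
Notation "⟨ x , f ⟩" := (pairing x f) (at level 0, x at level 99, f at level 99).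

Section Pairing.
Context {R : realType} {X : completeNormedModType R}.
Implicit Types (f g : dual X) (D : set (dual X)).

Lemma pairing_linearP f (a : R) u v : ⟨a *: u + v, f⟩ = a * ⟨u, f⟩ + ⟨v, f⟩.
Proof. by have /asboolP[lf _] := dual_funP f; exact: lf. Qed.

Lemma pairingDl f u v : ⟨u + v, f⟩ = ⟨u, f⟩ + ⟨v, f⟩.
Proof. by have := pairing_linearP f 1 u v; rewrite scale1r mul1r. Qed.

Lemma pairing0l f : ⟨0, f⟩ = 0.
Proof. by have := pairingDl f 0 0; rewrite addr0; lra. Qed.

Lemma pairingZl f (a : R) u : ⟨a *: u, f⟩ = a * ⟨u, f⟩.
Proof. by have := pairing_linearP f a u 0; rewrite addr0 pairing0l addr0. Qed.

Lemma pairingNl f u : ⟨- u, f⟩ = - ⟨u, f⟩.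
Proof. by rewrite -scaleN1r pairingZl mulN1r. Qed.

Lemma pairingDr f g u : ⟨u, f + g⟩ = ⟨u, f⟩ + ⟨u, g⟩. Proof. by []. Qed.
Lemma pairingNr f u : ⟨u, - f⟩ = - ⟨u, f⟩. Proof. by []. Qed.
Lemma pairingZr (a : R) f u : ⟨u, a *: f⟩ = a * ⟨u, f⟩. Proof. by []. Qed.

Definition pairingE := (pairingDl, pairingNl, pairingZl, pairing0l,
  pairingDr, pairingNr, pairingZr).

Lemma pairing_le_norm f : exists2 K : R, 0 < K & forall h, ⟨h, f⟩ <= K * `|h|.
Proof.
have /asboolP[_ cf] := dual_funP f.
have : (fun x => ⟨x, f⟩) @ (0 : X) --> ⟨0, f⟩ by exact: cf.
rewrite pairing0l => /cvgrPdist_le /(_ 1 ltr01) /nbhs_normP[e /= e0 eP].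
exists (2 / e) => [|h]; first by rewrite divr_gt0.
have [->|h0] := eqVneq h 0; first by rewrite pairing0l normr0 mulr0.
have nh : 0 < `|h| by rewrite normr_gt0.
pose c := e / 2 / `|h|.
have c0 : 0 < c by rewrite !divr_gt0.
have ch : c * `|h| = e / 2 by rewrite divfK ?gt_eqF.
have : `|0 - ⟨c *: h, f⟩| <= 1.
  by apply: eP; rewrite /ball_/= sub0r normrN normrZ gtr0_norm// ch; lra.
rewrite sub0r normrN pairingZl => /ler_normlW cf1.
rewrite -(ler_pM2l c0) (le_trans cf1)// mulrCA ch le_eqVlt.
by apply/orP; left; apply/eqP; field; rewrite gt_eqF.
Qed.

Lemma norm_pairing_le f :
  exists2 K : R, 0 < K & forall h, `|⟨h, f⟩| <= K * `|h|.
Proof.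
have [K K0 fK] := pairing_le_norm f; exists K => // h.
by rewrite ler_norml fK andbT lerNl -pairingNl -(normrN h) fK.
Qed.

(** Reduces weak-star convergence to the pointwise one, so that neighbourhoods in
    the initial topology need not be unfolded again. *)
Lemma cvg_weak_star (F : set_system (dual X)) f : Filter F ->
  (forall h, (fun g => ⟨h, g⟩) @ F --> ⟨h, f⟩) <-> F --> (f : weak_star X).
Proof.
move=> FF.
have FE : (forall h, (fun g => ⟨h, g⟩) @ F --> ⟨h, f⟩) <->
    (fun g : dual X => g : {ptws X -> R^o}) @ F --> (f : {ptws X -> R^o}).
  by rewrite pointwise_cvgP.
rewrite FE; split=> [Ff|Ff].
  move=> A /= [_ [[B Bop <-] Bf sBA]].
  have /Ff : nbhs (f : {ptws X -> R^o}) B by exact: open_nbhs_nbhs.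
  by move=> FB; exact: (@filterS _ F FF _ _ sBA FB).
apply: cvg_trans (@initial_continuous _ _
  (fun g : dual X => (g : {ptws X -> R^o})) f).
exact: cvg_app.
Qed.

Definition ws_nbhd f (hs : seq X) (e : R) : set (dual X) :=
  [set g | forall h, h \in hs -> `|⟨h, g⟩ - ⟨h, f⟩| < e].

Lemma nbhs_weak_starP f (U : set (dual X)) :
  nbhs (f : weak_star X) U <->
  exists (hs : seq X) (e : R), 0 < e /\ ws_nbhd f hs e `<=` U.
Proof.
have evalc h : (fun g => ⟨h, g⟩) @ nbhs (f : weak_star X) --> ⟨h, f⟩.
  by move: h; apply/cvg_weak_star.
split=> [|[hs [e [e0 sU]]]]; last first.
  suff : nbhs (f : weak_star X) (ws_nbhd f hs e).
    exact: (@filterS _ (nbhs (f : weak_star X)) _ _ _ sU).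
  elim: hs {sU} => [|h hs IH].
    by apply: (@filterS _ (nbhs (f : weak_star X)) _ setT) => //; exact: filterT.
  have /cvgrPdist_lt/(_ e e0) gh := evalc h.
  apply: (@filterS2 _ (nbhs (f : weak_star X)) _ _ _ _ _ IH gh).
  move=> g /= {}IH {}gh k.
  by rewrite inE => /predU1P[->|/IH//]; rewrite distrC.
pose F : set_system (dual X) :=
  filter_from [set p : seq X * R | 0 < p.2] (fun p => ws_nbhd f p.1 p.2).
have FF : Filter F.
  apply: filter_from_filter; first by exists ([::], 1) => /=; exact: ltr01.
  move=> [s e] [s' e'] /= e0 e0'; exists (s ++ s', Num.min e e') => /=.
    by rewrite lt_min e0.
  move=> g /= gP; split=> h /= hs; have := gP h;
    by rewrite mem_cat hs ?orbT => /(_ isT); rewrite lt_min => /andP[].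
suff /(_ U)/[apply] : F --> (f : weak_star X).
  by move=> [[hs e] /= e0 sU]; exists hs, e.
apply/cvg_weak_star => h; apply/cvgrPdist_lt => e e0.
by exists ([:: h], e) => // g /(_ h); rewrite /= mem_head distrC; apply.
Qed.

(** The form in which weak-star closures are used: approximation on finitely many
    vectors. *)
Lemma ws_closureP D f :
  ws_closure D f <->
  forall (hs : seq X) (e : R), 0 < e -> exists2 d, D d & ws_nbhd f hs e d.
Proof.
split=> [Df hs e e0|DP U /nbhs_weak_starP[hs [e [e0 sU]]]].
  have /Df[d [Dd dP]] : nbhs (f : weak_star X) (ws_nbhd f hs e).
    by apply/nbhs_weak_starP; exists hs, e; split=> //; exact: subset_refl.
  by exists d.
by have [d Dd /sU Ud] := DP hs e e0; exists d.
Qed.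

End Pairing.

(** * Convexity and weak-star closures *)

Section Convex.
Context {R : realType}.

Lemma convex_setP (M : lmodType R) (A : set M) :
  @convex_set R M A <->
  forall (t : R) a b, 0 <= t -> t <= 1 -> A a -> A b -> A (t *: a + (1 - t) *: b).
Proof.
split=> [cA t a b t0 t1 Aa Ab|cA a b t /set_mem Aa /set_mem Ab].
  by have /set_mem := cA a b (Itv01 t0 t1) (mem_set Aa) (mem_set Ab).
by apply/mem_set; exact: cA.
Qed.

Lemma smallest_convex (M : lmodType R) (A : set M) :
  @convex_set R M (smallest (@convex_set R M) A).
Proof.
apply/convex_setP => t a b t0 t1 Aa Ab C CA.
have [/convex_setP cC _] := CA.
by apply: cC => //; [exact: Aa|exact: Ab].
Qed.

Lemma lt_conv (t a b c : R) : 0 <= t -> t <= 1 -> a < c -> b < c ->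
  t * a + (1 - t) * b < c.
Proof.
move=> t0 t1 ac bc; have [->|tN0] := eqVneq t 0; first lra.
have {tN0} : 0 < t by rewrite lt_neqAle eq_sym tN0.
by nra.
Qed.

Context {X : completeNormedModType R}.
Implicit Types (p : dual X) (D : set (dual X)).

Lemma conv_hull_sub (C D : set (dual X)) :
  @convex_set R (dual X) C -> D `<=` C -> conv_hull D `<=` C.
Proof. by move=> cC DC; exact: smallest_sub. Qed.

Lemma sub_conv_hull D : D `<=` conv_hull D.
Proof. exact: sub_gen_smallest. Qed.

Lemma conv_hullS (D D' : set (dual X)) : D `<=` D' -> conv_hull D `<=` conv_hull D'.
Proof. by apply: sub_smallest2r; exact: smallest_convex. Qed.

Lemma sub_ws_closure D : D `<=` ws_closure D.
Proof. exact: (@subset_closure (weak_star X)). Qed.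

Lemma ws_closureS (D D' : set (dual X)) :
  D `<=` D' -> ws_closure D `<=` ws_closure D'.
Proof. exact: (@closureS (weak_star X)). Qed.

Lemma ws_closure_idem D : ws_closure (ws_closure D) `<=` ws_closure D.
Proof. by move=> p; rewrite /ws_closure -(closure_id _).1//; exact: closed_closure. Qed.

Lemma ws_closure_convex D :
  @convex_set R (dual X) D -> @convex_set R (dual X) (ws_closure D).
Proof.
move=> /convex_setP cD; apply/convex_setP => t p q t0 t1 /ws_closureP Dp /ws_closureP Dq.
apply/ws_closureP => hs e e0.
have [d Dd dp] := Dp hs e e0; have [d' Dd' dq] := Dq hs e e0.
exists (t *: d + (1 - t) *: d'); first exact: cD.
move=> h hhs; have := dp h hhs; have := dq h hhs; rewrite !pairingE => dqh dph.
have -> : t * ⟨h, d⟩ + (1 - t) * ⟨h, d'⟩ - (t * ⟨h, p⟩ + (1 - t) * ⟨h, q⟩) =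
  t * (⟨h, d⟩ - ⟨h, p⟩) + (1 - t) * (⟨h, d'⟩ - ⟨h, q⟩) by ring.
have t1' : 0 <= 1 - t by rewrite subr_ge0.
rewrite (le_lt_trans (ler_normD _ _))// !normrM (ger0_norm t0) (ger0_norm t1').
exact: lt_conv.
Qed.

Lemma halfspace_convex (v : X) (c : R) :
  @convex_set R (dual X) [set p : dual X | c <= ⟨v, p⟩].
Proof.
by apply/convex_setP => t p q t0 t1 /= cp cq; rewrite !pairingE; nra.
Qed.

Lemma ws_closure_halfspace D (v : X) (c : R) :
  (forall d, D d -> c <= ⟨v, d⟩) -> forall p, ws_closure D p -> c <= ⟨v, p⟩.
Proof.
move=> Dc p /ws_closureP Dp; apply/ler_addgt0Pr => e e0.
have [d /Dc cd /(_ v)] := Dp [:: v] e e0.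
by rewrite /= mem_head => /(_ isT); rewrite ltr_norml => /andP[? ?]; lra.
Qed.

(** Half-spaces given by vectors of [X] are convex and weak-star closed, so an
    inequality that is affine in the functional extends from a set to its closed
    convex hull. This is the only way in which hulls and closures enter part (i). *)
Lemma hull_halfspace D (v : X) (c : R) :
  (forall d, D d -> c <= ⟨v, d⟩) ->
  forall p, ws_closure (conv_hull D) p -> c <= ⟨v, p⟩.
Proof.
by move=> Dc; apply: ws_closure_halfspace; apply: conv_hull_sub => //;
  exact: halfspace_convex.
Qed.

Lemma mem_ball_around (x u : X) (e : R) :
  0 < e -> ball_around x e u <-> `|u - x| <= e.
Proof.
move=> e0; split=> [[v /= v1 <-]|ux].
  by rewrite addrC addKr normrZ gtr0_norm// ger_pMr.
exists (e^-1 *: (u - x)); last first.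
  by rewrite scalerA divff ?gt_eqF// scale1r addrC subrK.
by rewrite /unit_ball/= normrZ gtr0_norm ?invr_gt0// ler_pdivrMl// mulr1.
Qed.

Lemma interior_ball (D : set X) y : interior D y ->
  exists2 d : R, 0 < d & forall z, `|z - y| <= d -> D z.
Proof.
move=> /nbhs_closedballP[d dD]; exists d%:num => // z zy; apply: dD.
by rewrite closed_ballE// /closed_ball_/= distrC.
Qed.

End Convex.

(** * Coercivity of monotone operators at interior points of the domain *)

Section Estimates.
Context {R : realType} {X : completeNormedModType R}.
Context (A : X -> set (dual X)).

(** Adding one monotonically related pair to the graph keeps it monotone, so
    maximality forces the pair to be in the graph already. *)
Lemma maximal_mem x (p : dual X) : maximally_monotone A ->
  (forall u us, A u us -> ⟨x - u, us⟩ <= ⟨x - u, p⟩) -> A x p.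
Proof.
move=> [monA maxA] px.
pose B y := [set q | A y q \/ (y = x /\ q = p)].
have monB : monotone_op B.
  move=> u us v vs; rewrite /gra/= => -[Au|[-> ->]] [Av|[-> ->]].
  - exact: monA.
  - by have := px _ _ Au; rewrite /= !pairingE; lra.
  - by have := px _ _ Av; rewrite /= !pairingE; lra.
  - by rewrite subrr pairing0l.
have AB : gra A `<=` gra B by move=> [u us] Au; left.
have : gra B (x, p) by right.
by rewrite (maxA B monB AB).
Qed.

Context (monA : monotone_op A).

Lemma monotone_pairing u us v vs : A u us -> A v vs -> ⟨v - u, us⟩ <= ⟨v - u, vs⟩.
Proof. by move=> Au Av; have := @monA _ _ _ _ Av Au; rewrite /= !pairingE; lra. Qed.

Lemma dom_affine_bound v : dom A v ->
  exists2 N : R, 0 < N & forall u us, A u us -> ⟨v - u, us⟩ <= N * (1 + `|u|).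
Proof.
move=> [vs Av]; have [K K0 vsK] := pairing_le_norm vs.
exists (K * (1 + `|v|)) => [|u us Au]; first by rewrite mulr_gt0// ltr_wpDr.
rewrite (le_trans (monotone_pairing Au Av))// (le_trans (vsK _))// -mulrA ler_pM2l//.
have := ler_normB v u; have := normr_ge0 v; have := normr_ge0 u; nra.
Qed.

(** Dividing [us] by <<b = ⟨u - y, us⟩ + C (1 + |u|)>> makes the graph a pointwise
    bounded family: for small [s] both [y + s h] and [y - s h] lie in the domain, and the
    affine bounds at these two points control <<s |⟨h, us⟩|>> by a multiple of [b].
    Banach-Steinhaus then bounds the norms of all <<us / b>> at once. *)
Lemma global_coercivity y : interior (dom A) y ->
  exists K C : R, [/\ 0 < K, 0 <= C & forall u us, A u us ->
    let b := ⟨u - y, us⟩ + C * (1 + `|u|) in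
    0 <= b /\ forall h, ⟨h, us⟩ <= K * `|h| * b].
Proof.
move=> iy; have [d d0 dA] := interior_ball iy.
have [N N0 AN] : exists2 N : R, 0 < N &
    forall u us, A u us -> ⟨y - u, us⟩ <= N * (1 + `|u|).
  by apply/dom_affine_bound/dA; rewrite subrr normr0 ltW.
pose b u us := ⟨u - y, us⟩ + (N + 1) * (1 + `|u|).
have b1 u us : A u us -> 1 + `|u| <= b u us.
  by move=> /AN; rewrite /b !pairingE; lra.
have b0 u us : A u us -> 0 < b u us.
  by move=> /b1; apply: lt_le_trans; rewrite ltr_wpDr.
pose F : set (X -> R^o) :=
  [set g | exists u us, A u us /\ g = dual_fun ((b u us)^-1 *: us)].
have Fbl g : F g -> bounded_fun_norm g /\ linear g.
  move=> [u [us [_ ->]]]; set q := _ *: us; split; last first.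
    by have /asboolP[] := dual_funP q.
  have [K K0 qK] := norm_pairing_le q.
  by move=> r; exists (K * r) => x xr; rewrite (le_trans (qK _))// ler_pM2l.
have Fpt : pointwise_bounded F.
  move=> h; pose s := d / (1 + `|h|).
  have h1 : 0 < 1 + `|h| by rewrite ltr_wpDr.
  have s0 : 0 < s by rewrite divr_gt0.
  have sh : s * `|h| <= d.
    by rewrite mulrAC ler_pdivrMr// ler_pM2l// lerDr.
  have [N1 N10 AN1] : exists2 N : R, 0 < N & forall u us, A u us ->
      ⟨y + s *: h - u, us⟩ <= N * (1 + `|u|).
    by apply/dom_affine_bound/dA; rewrite addrC addKr normrZ gtr0_norm.
  have [N2 N20 AN2] : exists2 N : R, 0 < N & forall u us, A u us ->
      ⟨y - s *: h - u, us⟩ <= N * (1 + `|u|).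
    by apply/dom_affine_bound/dA; rewrite addrC addKr normrN normrZ gtr0_norm.
  exists ((1 + N1 + N2) / s) => _ [u [us [Au ->]]].
  have := b1 _ _ Au; have := AN1 _ _ Au; have := AN2 _ _ Au.
  have := b0 _ _ Au; rewrite -/⟨h, _⟩ pairingZr.
  set B := b u us => B0 h2 h1' h3.
  rewrite normrM gtr0_norm ?invr_gt0//.
  rewrite mulrC ler_pdivrMr// mulrAC ler_pdivlMr//.
  rewrite -[X in _ * X](gtr0_norm s0) -normrM.
  move: h1' h2 h3; rewrite /B /b !pairingE; have := normr_ge0 u.
  set a := ⟨h, us⟩; move=> u0 h1' h2 h3; rewrite ler_norml; apply/andP.
  by split; nra.
have [M FM] := Banach_Steinhauss Fbl Fpt 1.
exists (`|M| + 1), (N + 1); split; [by rewrite ltr_wpDl|lra|].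
move=> u us Au /=; rewrite -/(b u us); split=> [|h]; first by rewrite ltW ?b0.
have [->|h0] := eqVneq h 0; first by rewrite pairing0l normr0 mulr0 mul0r.
have nh : 0 < `|h| by rewrite normr_gt0.
have /FM/(_ (`|h|^-1 *: h)) : F (dual_fun ((b u us)^-1 *: us)) by exists u, us.
rewrite normrZ ger0_norm ?invr_ge0// mulVf ?gt_eqF// => /(_ (lexx _)).
rewrite -/⟨_, _⟩ !pairingE => /ler_normlW.
rewrite ler_pdivrMl// ler_pdivrMl ?b0// => /le_trans; apply.
rewrite mulrC (mulrC `|h|).
by rewrite ler_pM2r ?b0// ler_pM2r// (le_trans (ler_norm M))// lerDl.
Qed.

(** Localizing [global_coercivity] near [x] lets [x] replace the moving point [u]
    in the pairing: if <<|u - x| <= (2 K)^-1>>, the error <<⟨u - x, us⟩>> is at most half of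
    the factor [b] there and is absorbed. *)
Lemma local_coercivity x y : interior (dom A) y ->
  exists K C r : R, [/\ 0 < K, 0 < r & forall u us, `|u - x| <= r -> A u us ->
    0 <= ⟨x - y, us⟩ + C /\
    forall h, ⟨h, us⟩ <= K * `|h| * (⟨x - y, us⟩ + C)].
Proof.
move=> /global_coercivity[K [C [K0 C0 KC]]].
pose r := (2 * K)^-1.
have r0 : 0 < r by rewrite invr_gt0 mulr_gt0.
exists (2 * K), (C * (1 + `|x| + r)), r; split=> //; first by rewrite mulr_gt0.
move=> u us ux Au; have [b0 usK] := KC u us Au.
set b := ⟨u - y, us⟩ + _ in b0 usK; set c := ⟨x - y, us⟩ + _.
have : ⟨u - x, us⟩ <= b / 2.
  rewrite (le_trans (usK _))// mulrC ler_wpM2l//.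
  rewrite -(ler_pM2l K0) in ux; rewrite (le_trans ux)//.
  by rewrite le_eqVlt; apply/orP; left; apply/eqP; rewrite /r; field; rewrite gt_eqF.
have : C * (1 + `|u|) <= C * (1 + `|x| + r).
  rewrite ler_wpM2l// -addrA lerD2l -lerBlDl (le_trans _ ux)//.
  by rewrite lerB_dist.
move=> h1 h2.
have bc : b <= 2 * c by move: h2; rewrite /c /b !pairingE; lra.
split=> [|h]; first lra.
rewrite (le_trans (usK h))//.
have -> : 2 * K * `|h| * c = K * `|h| * (2 * c) by ring.
by rewrite ler_wpM2l ?mulr_ge0 ?(ltW K0).
Qed.

End Estimates.

(** * The operators [hat_op] and [hat_restr_op] *)

Lemma ler_addgt0_small (R : realType) (r a b Q : R) : 0 < r ->
  (forall e, 0 < e -> e <= r -> a <= b + e * Q) -> a <= b.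
Proof.
move=> r0 H; apply/ler_addgt0Pr => e e0.
pose d := Num.min r (e / (1 + `|Q|)).
have Q1 : 0 < 1 + `|Q| by rewrite ltr_wpDr.
have d0 : 0 < d by rewrite lt_min r0 divr_gt0.
have := H d d0; rewrite ge_min lexx => /(_ isT) /le_trans; apply.
rewrite lerD2l (@le_trans _ _ (d * (1 + `|Q|)))//.
  by rewrite ler_pM2l// (le_trans (ler_norm _))// lerDr.
by rewrite -ler_pdivlMr// ge_min lexx orbT.
Qed.

Section Hat.
Context {R : realType} {X : completeNormedModType R}.
Context (A : X -> set (dual X)).
Context (maxA : maximally_monotone A) (intA : interior (dom A) !=set0).

(** For [a] in [A w] with <<|w - x| <= e>>, monotonicity against [(u, us)] compares
    [a] and [us] on [w - u]; passing from [w] to [x] costs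
    <<e (N + K (⟨x - y, a⟩ + C))>> by coercivity. As that cost is affine in [a], the
    inequality reaches the closed convex hull, and [e] tends to 0. *)
Lemma hat_op_sub x : hat_op A x `<=` A x.
Proof.
move=> p px; apply: maximal_mem => // u us Au.
have [y iy] := intA.
have [K [C [r [K0 r0 coer]]]] := local_coercivity (proj1 maxA) x iy.
have [N N0 usN] := norm_pairing_le us.
apply: (@ler_addgt0_small _ r _ _ (N + K * C + K * ⟨x - y, p⟩)) => // e e0 er.
suff : ⟨x - u, us⟩ - e * (N + K * C) <= ⟨x - u + (K * e) *: (x - y), p⟩.
  by rewrite !pairingE; lra.
apply: hull_halfspace (px e e0) => a [w /= /mem_ball_around -/(_ e0) wx Aw].
have [c0 /(_ (w - x))] := coer w a (le_trans wx er) Aw.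
set c := _ + C in c0 *.
have : K * `|w - x| * c <= K * e * c by rewrite ler_wpM2r// ler_pM2l.
have := monotone_pairing (proj1 maxA) Au Aw.
have /ler_normlP[] := usN (w - x).
have : N * `|w - x| <= N * e by rewrite ler_pM2l.
rewrite /c !pairingE; lra.
Qed.

Lemma hat_restr_op_hat S x : hat_restr_op A S x `<=` hat_op A x.
Proof.
move=> p px e e0; apply: ws_closureS (px e e0); apply: conv_hullS.
by move=> a [w [_ wx] Aw]; exists w.
Qed.

(** A neighbourhood of [(x, p)] in the product contains graph points over
    [S] within [e] of [x]; no boundedness is involved. *)
Lemma restr_op_sub S x : restr_op A S x `<=` hat_restr_op A S x.
Proof.
move=> p px e e0; apply: (ws_closureS (@sub_conv_hull _ _ _)) => U pU.
have : nbhs ((x, p) : X * weak_star X) (ball x e `*` U).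
  by exists (ball x e, U) => //; split=> //; exact: nbhsx_ballx.
move=> /px[[u us] /= [[Au [Su _]] [xu Uu]]]; exists us; split=> //.
exists u => //; split=> //; apply/mem_ball_around => //.
by move: xu; rewrite -ball_normE/= distrC => /ltW.
Qed.

Lemma hat_opE x : A x = hat_op A x.
Proof.
apply/seteqP; split=> [p Ap e e0|]; last exact: hat_op_sub.
apply: sub_ws_closure; apply: sub_conv_hull; exists x => //.
by apply/mem_ball_around => //; rewrite subrr normr0 ltW.
Qed.

Lemma property_Q_maximal : property_Q A.
Proof.
move=> J le x_ x dJ xJ p Hp; apply: hat_op_sub => e e0.
have [j _ jP] : (x_ @ net_tails le) (ball x e) by apply: xJ; exact: nbhsx_ballx.
apply: ws_closureS (Hp j I); apply: conv_hullS => a [b /= jb Ab].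
exists (x_ b) => //; apply/mem_ball_around => //.
by have := jP b jb; rewrite -ball_normE/= distrC => /ltW.
Qed.

Lemma gra_norm_ws_closed : norm_ws_closed (gra A).
Proof.
move=> [x p] xp; apply: hat_op_sub; apply: (@hat_restr_op_hat setT).
apply: restr_op_sub; move: xp; rewrite /restr_op/= /norm_ws_closure.
by apply: closureS => q Aq; split.
Qed.

Lemma hat_restr_op_convex S x : @convex_set R (dual X) (hat_restr_op A S x).
Proof.
apply/convex_setP => t p q t0 t1 px qx e e0.
have /convex_setP := ws_closure_convex (@smallest_convex _ _ (op_image A (S `&` ball_around x e))).
by apply=> //; [exact: px|exact: qx].
Qed.

Lemma hat_restr_op_closed S x : ws_closure (hat_restr_op A S x) `<=` hat_restr_op A S x.
Proof.
move=> p px e e0; apply: ws_closure_idem; apply: ws_closureS px => q; exact.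
Qed.

Lemma hull_restr_op_sub S x :
  ws_closure (conv_hull (restr_op A S x)) `<=` hat_restr_op A S x.
Proof.
apply: subset_trans (@hat_restr_op_closed S x); apply: ws_closureS.
by apply: conv_hull_sub; [exact: hat_restr_op_convex|exact: restr_op_sub].
Qed.

End Hat.

(** * Minimax and solvability of systems of linear inequalities *)

Section PlanarMinimax.
Context {R : realType}.

(** Two-function minimax without compactness of [E]. If no point of [E] has both
    coordinates above [- e], the points that are good for a weight [t] split into
    those with small second coordinate (weights above some threshold) and those with
    small first coordinate (weights below). A weight cannot be good for both kinds, since
    the segment joining them would meet the corner; and the slack [e / 2] makes both
    sets of weights relatively open, against connectedness of [[0, 1]], here argued
    at the supremum of the second set. *)
Lemma planar_minimax (E : R -> R -> Prop) (e : R) :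
  (forall s a b a' b', 0 <= s -> s <= 1 -> E a b -> E a' b' ->
    E (s * a + (1 - s) * a') (s * b + (1 - s) * b')) ->
  (forall t, 0 <= t -> t <= 1 -> exists a b, E a b /\ 0 <= t * a + (1 - t) * b) ->
  0 < e -> exists a b, [/\ E a b, - e <= a & - e <= b].
Proof.
move=> cE H e0; apply: contrapT => noE.
have no a b : E a b -> - e <= a -> b < - e.
  by move=> Eab ea; rewrite ltNge; apply/negP => eb; apply: noE; exists a, b.
pose val t (a b : R) := t * a + (1 - t) * b.
have disj t a b a' b' : t <= 1 -> E a b -> - e <= a -> - (e / 2) <= val t a b ->
    E a' b' -> - e <= b' -> - (e / 2) <= val t a' b' -> False.
  move=> t1 Eab ea vab Eab' eb' vab'.
  have a'e : a' < - e.
    by rewrite ltNge; apply/negP => /(no _ _ Eab'); rewrite ltNge eb'.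
  have aa' : 0 < a - a' by lra.
  (* [s] is chosen so that the mixture has first coordinate exactly [- e]. *)
  pose s := (- e - a') / (a - a').
  have s0 : 0 <= s by rewrite divr_ge0 ?ltW//; lra.
  have s1 : s <= 1 by rewrite ler_pdivrMr//; lra.
  have sa : s * a + (1 - s) * a' = - e by rewrite /s; field; rewrite gt_eqF.
  have := cE _ _ _ _ _ s0 s1 Eab Eab'; rewrite sa => /no/(_ (lexx _)) be.
  have : s * val t a b + (1 - s) * val t a' b' =
         t * - e + (1 - t) * (s * b + (1 - s) * b') by rewrite -sa /val; ring.
  nra.
pose L : set R := [set t | [/\ 0 <= t, t <= 1 &
  exists a b, [/\ E a b, - e <= b & - (e / 2) <= val t a b]]].
have L0 : L 0.
  have [a [b [Eab]]] := H 0 (lexx _) ler01; rewrite mul0r subr0 mul1r add0r => b0.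
  by split=> //; exists a, b; split=> //; rewrite /val; lra.
have supL : has_sup L by split; [exists 0|exists 1 => t []].
have t0 : 0 <= sup L by apply: ub_le_sup => //; exact: supL.2.
have t1 : sup L <= 1 by apply: ge_sup => [|t []//]; exists 0.
have [a [b [Eab vab]]] := H _ t0 t1.
have [be|eb] := ltP b (- e).
  have ea : - e <= a by rewrite leNgt; apply/negP => ae; nra.
  have ab : 0 < a - b by lra.
  have d0 : 0 < e / 2 / (a - b) by rewrite !divr_gt0.
  have [t [t0' t1' [a' [b' [Eab' eb' vab']]]]] := sup_adherent d0 supL.
  rewrite ltrBlDl -ltrBlDr ltr_pdivlMr// => td.
  by apply: (disj t a b a' b') => //; rewrite /val; nra.
have ae : a < - e.
  by rewrite ltNge; apply/negP => /(no _ _ Eab); rewrite ltNge eb.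
have ab : 0 < b - a by lra.
have lt1 : sup L < 1 by rewrite ltNge; apply/negP => ge1; nra.
pose d := Num.min (e / 2 / (b - a)) (1 - sup L).
have d0 : 0 < d by rewrite lt_min !divr_gt0//= subr_gt0.
have d1 : d <= 1 - sup L by rewrite ge_min lexx orbT.
have d2 : d * (b - a) <= e / 2 by rewrite -ler_pdivlMr// ge_min lexx.
suff : sup L + d <= sup L by lra.
apply: ub_le_sup; first exact: supL.2.
by split; [lra|lra|exists a, b; split=> //; rewrite /val; nra].
Qed.

End PlanarMinimax.

Section Minimax.
Context {R : realType} {X : completeNormedModType R}.

(** Weak-star compactness in filter form. Along an ultrafilter every bounded
    evaluation converges, and the pointwise limit inherits linearity and the bound,
    hence is continuous. The bound may hold on a different member of the filter for each
    [h], which is weaker than having a norm-bounded member. *)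
Lemma weak_star_cluster (F : set_system (dual X)) (K : R) : ProperFilter F ->
  (forall h, F [set d | ⟨h, d⟩ <= K * `|h|]) ->
  exists p, forall U, F U -> ws_closure U p.
Proof.
move=> PF FK; have [G [UG FG]] := ultraFilterLemma PF.
have Gcvg h : exists l : R, (fun d => ⟨h, d⟩) @ G --> l.
  have GK : G [set d | ⟨h, d⟩ \in `[- (K * `|h|), K * `|h|]].
    have := FG _ (FK (- h)); have := FG _ (FK h); apply: filterS2 => d /=.
    by rewrite normrN pairingNl in_itv/= lerNl => -> ->.
  have [l [_ lG]] := @segment_compact R _ _ ((fun d => ⟨h, d⟩) @ G) _ GK.
  exists l => V Vl.
  have [//|GnV] := in_ultra_setVsetC ((fun d => ⟨h, d⟩) @^-1` V) UG.
  by have [z []] := lG (~` V) V GnV Vl.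
have [L LP] := choice Gcvg.
have LE a u v : L (a *: u + v) = a * L u + L v.
  have := LP (a *: u + v).
  have : (fun d => ⟨a *: u + v, d⟩) @ G --> a * L u + L v.
    have -> : (fun d => ⟨a *: u + v, d⟩) = (fun d => a * ⟨u, d⟩ + ⟨v, d⟩).
      by apply/funext => d; rewrite !pairingE.
    by apply: cvgD; [apply: cvgM; [exact: cvg_cst|]|]; exact: LP.
  move=> c1 c2; exact: (cvg_unique _ c2 c1).
have LK h : L h <= K * `|h|.
  apply: (@closed_cvg _ _ _ _ (fun d => ⟨h, d⟩) [set l | l <= K * `|h|]) (LP h).
  - exact: closed_le.
  - exact: (FG _ (FK h)).
have Lcont : continuous (L : X -> R^o).
  have LKn h : `|L h| <= K * `|h|.
    rewrite ler_norml LK andbT lerNl -(normrN h) (le_trans _ (LK _))//.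
    by have := LE (-1) h 0; have := LE 1 0 0; rewrite scaleN1r scale1r !addr0; lra.
  move=> x; apply/cvgrPdist_le => e e0.
  have d0 : 0 < e / (1 + `|K|) by rewrite divr_gt0// ltr_wpDr.
  apply/nbhs_normP; exists (e / (1 + `|K|)) => //= y /ltW xy.
  have -> : L x - L y = L (x - y).
    by rewrite (addrC x) -(scaleN1r y) LE; lra.
  rewrite (le_trans (LKn _))// (@le_trans _ _ ((1 + `|K|) * `|x - y|))//.
    by rewrite ler_wpM2r// (le_trans (ler_norm _))// lerDr.
  by rewrite mulrC -ler_pdivlMr// ltr_wpDr.
have LinP : (L : X -> R^o) \in linear_continuous_fun.
  by apply/asboolP; split=> // a u v; exact: LE.
exists (Dual LinP) => U FU.
have GL : G --> (Dual LinP : weak_star X) by apply/cvg_weak_star => h; exact: LP.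
move=> V /GL GV.
have : G (U `&` V) by apply: filterI => //; exact: FG.
by move=> /filter_ex.
Qed.

(** [G v r] stands for the inequality <<r <= ⟨v, d⟩>> in the unknown functional [d];
    convexity of the set of inequalities replaces the usual quantification over weights. *)
Definition convex_system (G : X -> R -> Prop) :=
  forall t v r v' r', 0 <= t -> t <= 1 -> G v r -> G v' r' ->
    G (t *: v + (1 - t) *: v') (t * r + (1 - t) * r').

Definition singly_solvable (D : set (dual X)) (G : X -> R -> Prop) :=
  forall v r e, G v r -> 0 < e -> exists2 d, D d & r - e <= ⟨v, d⟩.

Definition slack_solutions (D : set (dual X)) (s : seq (X * R)) (e : R) : set (dual X) :=
  [set d | D d /\ forall c, c \in s -> c.2 - e <= ⟨c.1, d⟩].

(** Induction on the list: cutting [D] by the first inequality (with slack) leaves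
    a convex set in which every single inequality of [G] is still solvable, because
    [planar_minimax] solves it together with the first one, all their mixtures
    belonging to [G]. *)
Lemma finite_system_solvable (G : X -> R -> Prop) (s : seq (X * R)) (D : set (dual X)) e :
  convex_system G -> @convex_set R (dual X) D -> D !=set0 -> singly_solvable D G ->
  (forall c, c \in s -> G c.1 c.2) -> 0 < e -> slack_solutions D s e !=set0.
Proof.
move=> cG; elim: s D => [|[v0 r0] s IH] D cD D0 DG sG e0.
  by have [d Dd] := D0; exists d.
pose D' : set (dual X) := [set d | D d /\ r0 - e <= ⟨v0, d⟩].
have G0 : G v0 r0 by apply: (sG (v0, r0)); rewrite mem_head.
have /convex_setP cDP := cD.
have cD' : @convex_set R (dual X) D'.
  apply/convex_setP => t p q t0 t1 [Dp pr] [Dq qr]; split; first exact: cDP.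
  by have /convex_setP := @halfspace_convex R X v0 (r0 - e); apply.
have D'G : singly_solvable D' G.
  move=> v r e' Gv e'0.
  (* Both coordinates are shifted by [k], so the slack [k] of [planar_minimax]
     costs [2 k <= min (e, e')] in total. *)
  pose k := Num.min e e' / 2.
  have k0 : 0 < k by rewrite divr_gt0// lt_min e0.
  pose E a b := exists d, [/\ D d, a = ⟨v0, d⟩ - r0 + k & b = ⟨v, d⟩ - r + k].
  have [||//|a [b [[d [Dd -> ->]] ka kb]]] := @planar_minimax R E k.
  - move=> t _ _ _ _ t0 t1 [p [Dp -> ->]] [q [Dq -> ->]].
    exists (t *: p + (1 - t) *: q); split; first exact: cDP.
      by rewrite !pairingE; ring.
    by rewrite !pairingE; ring.
  - move=> t t0 t1; have [d Dd] := DG _ _ _ (cG _ _ _ _ _ t0 t1 G0 Gv) k0.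
    rewrite !pairingE => dP; exists (⟨v0, d⟩ - r0 + k), (⟨v, d⟩ - r + k).
    by split; [exists d|lra].
  have [ke ke'] : k <= e / 2 /\ k <= e' / 2.
    by rewrite !ler_pM2r ?invr_gt0// !ge_min !lexx orbT.
  by exists d; [split=> //|]; lra.
have D'0 : D' !=set0 by have [d D'd _] := D'G _ _ _ G0 e0; exists d.
have [c cs|d [[Dd d0] ds]] := IH D' cD' D'0 D'G _ e0.
  by apply: sG; rewrite inE cs orbT.
by exists d; split=> // c; rewrite inE => /predU1P[->|/ds].
Qed.

(** The sets of approximate solutions of finite subsystems generate a filter; the
    last hypothesis (the inequalities bound the unknown in each direction) makes
    it bounded, and its cluster points solve the system. *)
Lemma system_solvable (G : X -> R -> Prop) (D : set (dual X)) (K : R) :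
  convex_system G -> @convex_set R (dual X) D -> D !=set0 -> singly_solvable D G ->
  (forall h, exists2 s : seq (X * R), (forall c, c \in s -> G c.1 c.2) &
    forall d, slack_solutions D s 1 d -> ⟨h, d⟩ <= K * `|h|) ->
  exists2 p, ws_closure D p & forall v r, G v r -> r <= ⟨v, p⟩.
Proof.
move=> cG cD D0 DG GK.
pose B : set (seq (X * R) * R) :=
  [set p : seq (X * R) * R | (forall c, c \in p.1 -> G c.1 c.2) /\ 0 < p.2].
pose F : set_system (dual X) := filter_from B (fun p => slack_solutions D p.1 p.2).
have FF : ProperFilter F.
  apply: filter_from_proper; last first.
    by move=> [s e] [/= sG e0]; exact: (finite_system_solvable cG).
  apply: filter_from_filter; first by exists ([::], 1); split.
  move=> [s e] [s' e'] [/= sG e0] [/= s'G e'0].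
  exists (s ++ s', Num.min e e').
    split=> /= [c|]; last by rewrite lt_min e0.
    by rewrite mem_cat => /orP[/sG|/s'G].
  have [ee ee'] : Num.min e e' <= e /\ Num.min e e' <= e'.
    by rewrite !ge_min !lexx orbT.
  by move=> d [Dd dP]; split; split=> // c cs; have := dP c;
    rewrite mem_cat cs ?orbT => /(_ isT) /=; lra.
have [|p Fp] := @weak_star_cluster F K FF.
  move=> h; have [s sG sK] := GK h; exists (s, 1); last exact: sK.
  by split=> //=; exact: ltr01.
exists p => [|v r Gv].
  apply: Fp; exists ([::], 1); first by split=> //=; exact: ltr01.
  by move=> d [].
apply/ler_addgt0Pr => e e0; rewrite -lerBlDr.
apply: (@ws_closure_halfspace _ _ [set d | r - e <= ⟨v, d⟩]) => //.
apply: Fp; exists ([:: (v, r)], e); last first.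
  by move=> d [_ /(_ (v, r))]; apply; rewrite mem_head.
by split=> //= c; rewrite inE => /eqP ->.
Qed.

End Minimax.

(** * Convexity of the interior of the domain *)

Lemma conv_addr (R : pzRingType) (V : lmodType R) (t : R) (u v a : V) :
  t *: (u + a) + (1 - t) *: (v + a) = t *: u + (1 - t) *: v + a.
Proof.
by rewrite !scalerDr addrACA -(scalerDl a) (addrC t) subrK scale1r.
Qed.

Lemma conv_subl (R : pzRingType) (V : lmodType R) (t : R) (u v a : V) :
  t *: (a - u) + (1 - t) *: (a - v) = a - (t *: u + (1 - t) *: v).
Proof. by rewrite !(addrC a) conv_addr !scalerN opprD. Qed.

Section Segment.
Context {R : realType} {X : completeNormedModType R}.
Context (A : X -> set (dual X)).
Context (maxA : maximally_monotone A).
Let monA := proj1 maxA.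

(** The convex hull of the triples [(u, us, ⟨u, us⟩)] for [(u, us)] in the graph. As an
    inductive family it supports induction on each argument separately. *)
Inductive graph_conv : X -> dual X -> R -> Prop :=
| graph_conv_base u us : A u us -> graph_conv u us ⟨u, us⟩
| graph_conv_mix t u us r v vs q : 0 <= t -> t <= 1 ->
    graph_conv u us r -> graph_conv v vs q ->
    graph_conv (t *: u + (1 - t) *: v) (t *: us + (1 - t) *: vs)
      (t * r + (1 - t) * q).

(** On the graph itself this is monotonicity; the inequality is affine in each of
    the two triples, so it extends to the hull in one variable and then in the other.
    On the diagonal it says that the third component dominates the pairing. *)
Lemma graph_conv_mono u us r v vs q : graph_conv u us r -> graph_conv v vs q ->
  ⟨u, vs⟩ + ⟨v, us⟩ <= r + q.
Proof.
move=> gu gv; elim: gu => {u us r}[u us Au|t u us r u' us' r' t0 t1 _ h _ h'].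
  elim: gv => {v vs q}[v vs Av|t v vs q v' vs' q' t0 t1 _ h _ h'].
    by have := monotone_pairing monA Au Av; rewrite !pairingE; lra.
  by rewrite !pairingE; nra.
by rewrite !pairingE; nra.
Qed.

(** A functional [p] belongs to [A w] when <<⟨w - u, us⟩ <= ⟨w - u, p⟩>> on the graph. The
    convex hull of these inequalities is the system [G], and a member of [G] coming
    from [(u, us, q)] is solved by [us] itself, by [graph_conv_mono]. The inequalities at [x]
    and at points [y + k] near [y] bound the unknown in the direction [k], because [w]
    lies between [x] and [y]. *)
Lemma segment_dom x y t : dom A x -> interior (dom A) y -> 0 < t -> t <= 1 ->
  dom A (t *: y + (1 - t) *: x).
Proof.
move=> [xs Ax] iy t0 t1; set w := _ + _.
pose G v r := exists u us q,
  [/\ graph_conv u us q, v = w - u & r = ⟨w, us⟩ - q].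
have GA u us : A u us -> G (w - u) ⟨w - u, us⟩.
  move=> Au; exists u, us, ⟨u, us⟩; split=> //; first exact: graph_conv_base.
  by rewrite !pairingE.
have cG : convex_system G.
  move=> s _ _ _ _ s0 s1 [u [us [q [g -> ->]]]] [u' [us' [q' [g' -> ->]]]].
  do 3 eexists; split; first exact: (graph_conv_mix s0 s1 g g').
    by rewrite conv_subl.
  by rewrite !pairingE; ring.
have GT : singly_solvable [set: dual X] G.
  move=> _ _ e [u [us [q [g -> ->]]]] e0; exists us => //.
  by have := graph_conv_mono g g; rewrite !pairingE; lra.
have [K [C [r [K0 r0 coer]]]] := local_coercivity monA y iy.
have [d0 d0_gt0 dA] := interior_ball iy.
pose rho := Num.min r d0.
have rho0 : 0 < rho by rewrite lt_min r0.
have [rr rd] : rho <= r /\ rho <= d0 by rewrite !ge_min !lexx orbT.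
pose M := 1 + K * (`|y - w| + rho) * C + `|⟨x - w, xs⟩|.
have [|||p _ pG] := @system_solvable R X G setT (M / (t * rho)) cG _ _ GT.
- exact/convex_setP.
- by exists 0.
- move=> h; have [->|h0] := eqVneq h 0.
    by exists [::] => // d _; rewrite pairing0l normr0 mulr0.
  have nh : 0 < `|h| by rewrite normr_gt0.
  pose k := (rho / `|h|) *: h.
  have nk : `|k| = rho by rewrite normrZ gtr0_norm ?divr_gt0// divfK ?gt_eqF.
  have [q Aq] : dom A (y + k) by apply: dA; rewrite addrC addKr nk.
  have [C0 /(_ (y + k - w)) qK] : 0 <= ⟨y - y, q⟩ + C /\
      forall h, ⟨h, q⟩ <= K * `|h| * (⟨y - y, q⟩ + C).
    by apply: coer Aq; rewrite addrC addKr nk.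
  rewrite subrr pairing0l add0r in C0 qK.
  exists [:: (w - x, ⟨w - x, xs⟩); (w - (y + k), ⟨w - (y + k), q⟩)].
    by move=> c; rewrite !inE => /orP[] /eqP-> /=; exact: GA.
  move=> d [_ dP].
  have := dP (w - x, ⟨w - x, xs⟩); rewrite mem_head => /(_ isT) /= dx.
  have := dP (w - (y + k), ⟨w - (y + k), q⟩).
  rewrite !inE eqxx orbT => /(_ isT) /= dy.
  have tk : t * ⟨k, d⟩ <= M.
    have qM : ⟨y + k - w, q⟩ <= K * (`|y - w| + rho) * C.
      rewrite (le_trans qK)// ler_wpM2r// ler_pM2l//.
      by rewrite addrAC (le_trans (ler_normD _ _))// nk.
    have M0 : 0 <= K * (`|y - w| + rho) * C.
      by rewrite !mulr_ge0 ?addr_ge0 ?(ltW K0) ?(ltW rho0).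
    have t1' : 0 <= 1 - t by rewrite subr_ge0.
    have := ler_wpM2l (ltW t0) dy; have := ler_wpM2l t1' dx.
    have := ler_wpM2l (ltW t0) qM; have := ler_wpM2r M0 t1.
    have := ler_wpM2l t1' (ler_norm ⟨x - w, xs⟩).
    have := ler_wpM2r (normr_ge0 ⟨x - w, xs⟩) (_ : 1 - t <= 1).
    rewrite gerBl (ltW t0) => /(_ isT).
    rewrite /M !(pairingDl, pairingNl, pairingZl); lra.
  rewrite -(@ler_pM2l _ (t * rho / `|h|)) ?divr_gt0 ?mulr_gt0//.
  have -> : t * rho / `|h| * (M / (t * rho) * `|h|) = M.
    by field; rewrite !gt_eqF.
  by move: tk; rewrite pairingZl !mulrA.
exists p; apply: maximal_mem => // u us Au.
by apply: pG; exact: GA.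
Qed.

Lemma segment_interior x y t : dom A x -> interior (dom A) y -> 0 < t -> t <= 1 ->
  interior (dom A) (t *: y + (1 - t) *: x).
Proof.
move=> Ax iy t0 t1.
have iiy : interior (interior (dom A)) y by exact: nbhs_interior.
have [d d0 dA] := interior_ball iiy.
apply/nbhs_normP; exists (t * d) => [|z /=]; first by rewrite /= mulr_gt0.
set w := t *: y + _; rewrite distrC => /ltW zw.
have -> : z = t *: (y + t^-1 *: (z - w)) + (1 - t) *: x.
  rewrite scalerDr scalerA divff ?gt_eqF// scale1r addrAC -/w.
  by rewrite addrC subrK.
apply: segment_dom => //; apply: dA; rewrite addrC addKr normrZ.
by rewrite gtr0_norm ?invr_gt0// ler_pdivrMl.
Qed.

Lemma interior_dom_convex x y t : interior (dom A) x -> interior (dom A) y ->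
  0 <= t -> t <= 1 -> interior (dom A) (t *: y + (1 - t) *: x).
Proof.
move=> ix iy; rewrite le_eqVlt => /predU1P[<- _|t0 t1].
  by rewrite scale0r add0r subr0 scale1r.
by apply: segment_interior => //; exact: interior_subset.
Qed.

End Segment.

(** * Recession directions and the decomposition *)

Section Recession.
Context {R : realType} {X : completeNormedModType R}.
Context (A : X -> set (dual X)).
Context (maxA : maximally_monotone A) (intA : interior (dom A) !=set0).
Let monA := proj1 maxA.

(** Monotonicity between [(a n, as_ n)] and [(u, us)], scaled by [t n], passes to the
    limit; the term <<⟨a n - x, t n *: as_ n⟩>>, a product of a null and a merely weak-star
    convergent sequence, is handled by coercivity. *)
Lemma rec_op_normal x w u : rec_op A x w -> dom A u -> 0 <= ⟨x - u, w⟩.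
Proof.
move=> [t [a [as_ [t0 t_cvg Aa a_cvg as_cvg]]]] [us Au].
have [y iy] := intA.
have [K [C [r [K0 r0 coer]]]] := local_coercivity monA x iy.
have ev h : (fun n => ⟨h, t n *: as_ n⟩) @ \oo --> ⟨h, w⟩.
  have := (@cvg_weak_star R X ((fun n => t n *: as_ n) @ \oo) w _).2 as_cvg h.
  exact.
have ax0 : (fun n => `|a n - x|) @ \oo --> (0 : R).
  by rewrite -(normr0 X) -(subrr x); apply: cvg_norm; apply: cvgB => //; exact: cvg_cst.
have [N N0 usN] := norm_pairing_le us.
pose f n := t n * (⟨x - u, us⟩ - N * `|a n - x|) -
  K * `|a n - x| * (⟨x - y, t n *: as_ n⟩ + t n * C).
have f0 : f @ \oo --> (0 : R).
  have -> : 0 = 0 * (⟨x - u, us⟩ - N * 0) - K * 0 * (⟨x - y, w⟩ + 0 * C) :> R.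
    by ring.
  apply: cvgB; apply: cvgM => //.
  - by apply: cvgB; [exact: cvg_cst|apply: cvgM => //; exact: cvg_cst].
  - by apply: cvgM => //; exact: cvg_cst.
  - by apply: cvgD; [exact: ev|apply: cvgM => //; exact: cvg_cst].
apply: (ler_cvg_to f0 (ev (x - u))).
have := a_cvg; move/cvgrPdist_le => /(_ r r0); apply: filterS => n /=; rewrite distrC => an.
have [c0 /(_ (a n - x)) c1] := coer _ _ an (Aa n).
have := monotone_pairing monA Au (Aa n).
have /ler_normlP[usn _] := usN (a n - x).
rewrite /f !pairingZr -mulrDr mulrCA -mulrBr ler_pM2l//.
by move: c1 usn; rewrite !pairingE; lra.
Qed.

(** If [w] is normal at [x], the whole ray [a + m *: w] lies in [A x], so the constant
    sequence [x] realizes [w] as a recession direction. Normality over the interior of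
    the domain extends to the domain along segments. *)
Lemma normal_rec_op x a w : A x a ->
  (forall y, interior (dom A) y -> 0 <= ⟨x - y, w⟩) -> rec_op A x w.
Proof.
move=> Aa wP.
have [z iz] := intA.
have wdom u : dom A u -> 0 <= ⟨x - u, w⟩.
  move=> Au; apply: (@ler_addgt0_small _ 1 _ _ (⟨u - z, w⟩)) => // e e0 e1.
  have := wP _ (segment_interior maxA Au iz e0 e1).
  by rewrite !pairingE; lra.
exists (fun n => n.+1%:R^-1), (fun=> x), (fun n => a + n.+1%:R *: w).
split=> [n||n||].
- by rewrite invr_gt0.
- exact: cvg_harmonic.
- apply: maximal_mem => // u us Au; rewrite pairingDr pairingZr.
  have := monotone_pairing monA Au Aa; have : dom A u by exists us.
  move=> /wdom w0; have : 0 <= n.+1%:R * ⟨x - u, w⟩ by rewrite mulr_ge0.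
  lra.
- exact: cvg_cst.
- apply/cvg_weak_star => h.
  suff : (fun n => ⟨h, n.+1%:R^-1 *: (a + n.+1%:R *: w)⟩) @ \oo --> ⟨h, w⟩ by exact.
  have -> : (fun n => ⟨h, n.+1%:R^-1 *: (a + n.+1%:R *: w)⟩) =
            (fun n => n.+1%:R^-1 * ⟨h, a⟩ + ⟨h, w⟩).
    by apply/funext => n; rewrite !pairingE mulrDr mulKf.
  rewrite -[X in _ --> X]add0r -(mul0r ⟨h, a⟩).
  apply: cvgD; last exact: cvg_cst.
  by apply: cvgM; [exact: cvg_harmonic|exact: cvg_cst].
Qed.

Lemma add_rec_op_sub x : minkowski_sum (A x) (rec_op A x) `<=` A x.
Proof.
move=> _ [c Ac [w wx <-]]; apply: maximal_mem => // u us Au.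
have : dom A u by exists us.
move=> /(rec_op_normal wx); have := monotone_pairing monA Au Ac.
by rewrite pairingDr; lra.
Qed.

Section DenseSubset.
Context (S : set X).
Context (SA : S `<=` interior (dom A)) (denseS : interior (dom A) `<=` closure S).

(** Points of [S] close to [x + t v] relative to [t] satisfy, by monotonicity against
    [(x, a)], almost <<⟨v, a⟩ <= ⟨v, s⟩>>. This bounds <<⟨x - y, s⟩>> from above, so
    coercivity bounds their images [s], which therefore cluster as [t] tends to 0. *)
Lemma hat_restr_op_support x a y : A x a -> interior (dom A) y ->
  exists2 c, hat_restr_op A S x c & ⟨y - x, a⟩ <= ⟨y - x, c⟩.
Proof.
move=> Aa iy; set v := y - x.
have [K [C [r [K0 r0 coer]]]] := local_coercivity monA x iy.
have [Ka Ka0 aK] := pairing_le_norm a.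
pose Q := `|C - ⟨v, a⟩| + Ka.
have Q0 : 0 < Q by rewrite ltr_wpDl.
pose P e : set (dual X) := [set s | exists u, [/\ S u, `|u - x| <= e, A u s,
  ⟨v, a⟩ - e <= ⟨v, s⟩ & forall h, ⟨h, s⟩ <= K * (2 * Q) * `|h|]].
have P0 e : 0 < e -> P e !=set0.
  move=> e0.
  have D0 : 0 < Ka + K * (2 * Q) by rewrite addr_gt0// !mulr_gt0.
  (* [th] measures the error relative to [t]: the second bound absorbs half of [b],
     the third keeps the final loss below [e]. *)
  pose th := Num.min (Num.min 1 (2 * K)^-1) (e / (Ka + K * (2 * Q))).
  have th0 : 0 < th by rewrite !lt_min ltr01 invr_gt0 (mulr_gt0 (ltr0Sn _ 1) K0) divr_gt0.
  have [th1 thK the] : [/\ th <= 1, K * th <= 2^-1 & th * (Ka + K * (2 * Q)) <= e].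
    split; first by rewrite !ge_min lexx.
      by rewrite -ler_pdivlMl// -invfM mulrC !ge_min lexx orbT.
    by rewrite -ler_pdivlMr// !ge_min lexx !orbT.
  pose t := Num.min 1 (Num.min e r / (`|v| + 1)).
  have v1 : 0 < `|v| + 1 by rewrite ltr_wpDl.
  have t0 : 0 < t by rewrite lt_min ltr01 divr_gt0// lt_min e0.
  have t1 : t <= 1 by rewrite ge_min lexx.
  have tv : t * (`|v| + 1) <= Num.min e r by rewrite -ler_pdivlMr// ge_min lexx orbT.
  set xt := t *: y + (1 - t) *: x.
  have xtE : xt - x = t *: v by rewrite -conv_addr subrr scaler0 addr0.
  have tth : 0 < t * th by rewrite mulr_gt0.
  have Ax : dom A x by exists a.
  have /denseS/(_ _ (nbhsx_ballx _ _ tth))[u [Su]] : interior (dom A) xt.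
    exact: segment_interior.
  rewrite -ball_normE/= distrC => /ltW.
  set d := u - xt => dth; have ux : u - x = t *: v + d.
    by rewrite -xtE [RHS]addrC /d addrA subrK.
  have [s As] := interior_subset (SA Su).
  have uxe : `|u - x| <= Num.min e r.
    rewrite (le_trans _ tv)// ux (le_trans (ler_normD _ _))// normrZ gtr0_norm//.
    by rewrite mulrDr mulr1 lerD2l (le_trans dth)// ger_pMr.
  move: uxe; rewrite le_min => /andP[uxe uxr].
  have [b0 sK] := coer _ _ uxr As.
  have bE : ⟨x - y, s⟩ + C = C - ⟨v, s⟩ by rewrite /v !pairingE; ring.
  rewrite {}bE in b0 sK.
  set b := C - ⟨v, s⟩ in b0 sK.
  have main : ⟨v, a⟩ - Ka * th <= ⟨v, s⟩ + K * th * b.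
    have := monotone_pairing monA Aa As.
    rewrite ux !(pairingDl _ (t *: v) d) !(pairingZl _ t v).
    have := aK (- d); rewrite normrN (pairingNl _ d).
    have := sK d; have := ler_wpM2l (ltW Ka0) dth.
    have := ler_wpM2r b0 (ler_wpM2l (ltW K0) dth).
    move=> h1 h2 h3 h4 h5; rewrite -(ler_pM2l t0); lra.
  have b2 : b <= 2 * Q.
    have := ler_norm (C - ⟨v, a⟩); have := ler_wpM2r b0 thK.
    have : Ka * th <= Ka by rewrite ger_pMr.
    by move: main; rewrite /Q /b; lra.
  exists s, u; split=> //.
    have := ler_wpM2l (ltW (mulr_gt0 K0 th0)) b2.
    by move: main the; lra.
  by move=> h; rewrite (le_trans (sK h))// mulrAC ler_wpM2r// ler_pM2l.
pose F : set_system (dual X) := filter_from [set e : R | 0 < e] P.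
have FF : ProperFilter F.
  apply: filter_from_proper; last exact: P0.
  apply: filter_from_filter; first by exists 1 => /=; exact: ltr01.
  move=> e e' /= e0 e'0; exists (Num.min e e'); first by rewrite /= lt_min e0.
  have [ee ee'] : Num.min e e' <= e /\ Num.min e e' <= e'.
    by rewrite !ge_min !lexx orbT.
  by move=> s [u [Su ux Au vs sK]]; split; exists u; split=> //; lra.
have [|c Fc] := @weak_star_cluster _ _ F (K * (2 * Q)) FF.
  by move=> h; exists 1 => [|s [u [_ _ _ _ sK]]]; [exact: ltr01|exact: sK].
exists c => [e e0|].
  apply: (ws_closureS (@sub_conv_hull _ _ _)); apply: Fc.
  exists e => // s [u [Su ux Au _ _]]; exists u => //; split=> //.
  exact/mem_ball_around.
apply/ler_addgt0Pr => e e0; rewrite -lerBlDr.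
apply: (@ws_closure_halfspace _ _ [set s | ⟨v, a⟩ - e <= ⟨v, s⟩]) => //.
by apply: Fc; exists e => // s [u []].
Qed.

(** The system asks for [c] with <<⟨y - x, a⟩ <= ⟨y - x, c⟩>> for all interior [y], so that
    [a - c] is normal. The single inequality for a fixed interior [z] already bounds
    [c] in every direction, by coercivity at [x], since [c] lies in [A x]. *)
Lemma sub_hat_restr_op_rec x :
  A x `<=` minkowski_sum (hat_restr_op A S x) (rec_op A x).
Proof.
move=> a Aa; have [z iz] := intA.
have hatA c : hat_restr_op A S x c -> A x c.
  by move=> /hat_restr_op_hat /(hat_op_sub maxA intA).
pose G v r := exists y, [/\ interior (dom A) y, v = y - x & r = ⟨y - x, a⟩].
have cG : convex_system G.
  move=> s _ _ _ _ s0 s1 [y [iy -> ->]] [y' [iy' -> ->]].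
  have yE : s *: y + (1 - s) *: y' - x = s *: (y - x) + (1 - s) *: (y' - x).
    by rewrite conv_addr.
  exists (s *: y + (1 - s) *: y'); split; rewrite ?yE//.
    exact: interior_dom_convex.
  by rewrite !pairingE; ring.
have DG : singly_solvable (hat_restr_op A S x) G.
  move=> _ _ e [y [iy -> ->]] e0.
  by have [c cx ca] := hat_restr_op_support Aa iy; exists c => //; lra.
have [K [C [r [K0 r0 coer]]]] := local_coercivity monA x iz.
have [|||p px pG] := @system_solvable R X G (hat_restr_op A S x)
  (K * (⟨x - z, a⟩ + 1 + C)) cG _ _ DG.
- exact: hat_restr_op_convex.
- by have [c cx _] := hat_restr_op_support Aa iz; exists c.
- move=> h; exists [:: (z - x, ⟨z - x, a⟩)].
    by move=> c; rewrite inE => /eqP ->; exists z.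
  move=> d [/hatA Ad /(_ (z - x, ⟨z - x, a⟩))]; rewrite mem_head => /(_ isT) /= zd.
  have [|_ /(_ h) dK] := coer x d _ Ad; first by rewrite subrr normr0 ltW.
  rewrite (le_trans dK)// mulrAC ler_wpM2r// ler_pM2l//.
  by move: zd; rewrite !pairingE; lra.
have {}px := hat_restr_op_closed px.
exists p => //; exists (a - p); last by rewrite addrC subrK.
apply: (normal_rec_op Aa) => y iy.
by have := pG _ _ (ex_intro _ y (And3 iy erefl erefl)); rewrite !pairingE; lra.
Qed.

End DenseSubset.
End Recession.

Theorem theorem4p12 (R : realType) (X : completeNormedModType R)
    (A : X -> set (dual X)) (maxA : maximally_monotone A)
    (intA : interior (dom A) !=set0) :
  [/\ forall x : X, A x = hat_op A x,
      property_Q A,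
      norm_ws_closed (gra A) &
      forall S : set X, S `<=` interior (dom A) ->
        interior (dom A) `<=` closure S ->
        (forall x : X,
           ws_closure (conv_hull (restr_op A S x)) `<=` hat_restr_op A S x) /\
        (forall x : X,
           A x = minkowski_sum (hat_restr_op A S x) (rec_op A x))].
Proof.
split; [exact: hat_opE|exact: property_Q_maximal|exact: gra_norm_ws_closed|].
move=> S SA denseS; split=> x; first exact: hull_restr_op_sub.
apply/seteqP; split; first exact: sub_hat_restr_op_rec.
move=> _ [c cx [w wx <-]]; apply: add_rec_op_sub => //.
exists c; last by exists w.
by apply: hat_op_sub => //; exact: hat_restr_op_hat cx.
Qed.
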